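(* Assume (A1)–(A5) of the context, and let $\{\bm{x}_{i,t}\}_{t=1}^T$, $i\in[m]$, be generated by Algorithm ODCMD with step size $\eta$ and optimization error sequence $\{\rho_t\}_{t=1}^T$. Then, for all $T\ge 1$ and any $j\in[m]$, $$\overline{\mathrm{Reg}}_j(T)\le \frac{\mathsf A_0}{T}+\mathsf A_1\frac{1}{\eta T}+\mathsf A_2\,\eta+\frac{\mathsf A_3}{T}\sum_{t=1}^T\sqrt{\eta\rho_t}+\frac{\mathsf A_4}{T}\sum_{t=1}^T\sqrt{\frac{\rho_t}{\eta}},$$ where $$\mathsf A_0=\frac{2\vartheta}{1-\kappa}(G_\ell+G_r)\Big(\sum_{i=1}^m\|\bm{x}_{i,1}\|\Big),\qquad \mathsf A_1=\sum_{i=1}^m V_\omega(\bm{x}^\star,\bm{x}_{i,1}),$$ $$\mathsf A_2=\frac{m}{\sigma_\omega}\Big(\tfrac12 G_\ell^2+G_r(G_\ell+G_r)+\frac{2\vartheta}{1-\kappa}(G_\ell+G_r)^2\Big),$$ $$\mathsf A_3=m\sqrt{\frac{2}{\sigma_\omega}}\Big(G_\ell+\frac{2\vartheta}{1-\kappa}(G_\ell+G_r)\Big),\qquad \mathsf A_4=2m\sqrt{\frac{2}{\sigma_\omega}}\,G_\omega D_{\mathcal K},$$ with $\vartheta=\big(1-\frac{\zeta}{4m^2}\big)^{-2}$ and $\kappa=\big(1-\frac{\zeta}{4m^2}\big)^{1/B}$.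
   Context: Notation: $[m]=\{1,\dots,m\}$; $\|\cdot\|$ is a norm on $\mathbb R^d$ with dual norm $\|\bm x\|_*=\max_{\|\bm y\|=1}\langle \bm x,\bm y\rangle$; $\nabla f(\bm x)$ denotes any (sub)gradient of $f$ at $\bm x$. Problem: $\mathcal K\subseteq\mathbb R^d$ is a convex constraint set, $\ell_{i,t}:\mathbb R^d\to\mathbb R$ is the convex loss function of node $i\in[m]$ at round $t\in[T]$, and $r$ is a convex, possibly nonsmooth, regularization function. Let $\bm x^\star=\arg\min_{\bm x\in\mathcal K}\sum_{t=1}^T\sum_{j=1}^m(\ell_{j,t}(\bm x)+r(\bm x))$. The average regularized regret of node $i$ over $T$ rounds is $$\overline{\mathrm{Reg}}_i(T)=\frac1T\sum_{t=1}^T\sum_{j=1}^m(\ell_{j,t}(\bm x_{i,t})+r(\bm x_{i,t}))-\frac1T\sum_{t=1}^T\sum_{j=1}^m(\ell_{j,t}(\bm x^\star)+r(\bm x^\star)).$$ Network: $\mathcal G_t=(\mathcal V,\mathcal E_t)$ with $\mathcal V=[m]$, weight matrix $\bm P(t)\in\mathbb R^{m\times m}$, and $\mathcal E_t=\{\{i,j\}: [\bm P(t)]_{ij}>0\}$. Bregman divergence: for a function $\omega:\mathbb R^d\to\mathbb R$, $V_\omega(\bm x,\bm y)=\omega(\bm x)-\omega(\bm y)-\langle\nabla\omega(\bm y),\bm x-\bm y\rangle$. Assumptions. (A1) (a) $\bm P(t)$ is doubly stochastic for all $t\ge1$; (b) there is $\zeta>0$ such that $[\bm P(t)]_{ii}\ge\zeta$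 for all $i$ and $t\ge1$, and $[\bm P(t)]_{ij}\ge\zeta$ if $\{i,j\}\in\mathcal E_t$; (c) there is an integer $B\ge1$ such that the graph $(\mathcal V,\mathcal E_{kB+1}\cup\dots\cup\mathcal E_{(k+1)B})$ is strongly connected for all $k\ge0$. (A2) $\|\bm x-\bm y\|\le D_{\mathcal K}$ for all $\bm x,\bm y\in\mathcal K$. (A3) Each $\ell_{i,t}$ is $G_\ell$-Lipschitz over $\mathcal K$ with respect to $\|\cdot\|$ (so that $\|\nabla\ell_{i,t}(\bm x)\|_*\le G_\ell$ for $\bm x\in\mathcal K$), and $r$ is $G_r$-Lipschitz over $\mathcal K$ with respect to $\|\cdot\|$. (A4) $\omega$ is $\sigma_\omega$-strongly convex on $\mathcal K$ with respect to $\|\cdot\|$, i.e. $\omega(\bm x)\ge\omega(\bm y)+\langle\nabla\omega(\bm y),\bm x-\bm y\rangle+\frac{\sigma_\omega}{2}\|\bm x-\bm y\|^2$, and $\|\nabla\omega(\bm x)-\nabla\omega(\bm y)\|_*\le G_\omega\|\bm x-\bm y\|$, for all $\bm x,\bm y\in\mathcal K$. (A5) $V_\omega(\bm x,\cdot)$ is convex in its second argument for every fixed $\bm x$, i.e. $V_\omega(\bm x,\sum_i\alpha_i\bm y_i)\le\sum_i\alpha_iV_\omega(\bm x,\bm y_i)$ for convex weights $\alpha_i$. Algorithm ODCMD (step size $\eta>0$, errors $\rho_t\ge0$): initialize $\bm x_{i,1}=\arg\min_{\bm x\in\mathcal K}\omega(\bm x)$ for $i\in[m]$. For $t=1,\dots,T$,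 each node $i$ receives $\nabla_{i,t}=\nabla\ell_{i,t}(\bm x_{i,t})$; with $F_{i,t}(\bm x)=\langle\nabla_{i,t},\bm x\rangle+r(\bm x)+\frac1\eta V_\omega(\bm x,\bm x_{i,t})$ and $\bm y_{i,t}^\star=\arg\min_{\bm x\in\mathcal K}F_{i,t}(\bm x)$, it computes some $\bm y_{i,t}\in\mathcal K$ with $F_{i,t}(\bm y_{i,t})\le F_{i,t}(\bm y_{i,t}^\star)+\rho_t$ (a $\rho_t$-approximate solution), and sets $\bm x_{i,t+1}=\sum_{j=1}^m[\bm P(t)]_{ij}\bm y_{j,t}$. *)

(* Defs.v *)
From HB Require Import structures.
From mathcomp Require Import all_boot all_order all_algebra.
From mathcomp Require Import all_classical all_reals all_analysis.

Set Implicit Arguments.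
Unset Strict Implicit.
Unset Printing Implicit Defensive.

Import Order.TTheory GRing.Theory Num.Theory.

Local Open Scope classical_set_scope.
Local Open Scope ring_scope.

(* Vectors of R^d are row vectors.  Their canonical MathComp norm is the sup
   norm, so an arbitrary norm on R^d is a function N : 'rV[R]_d -> R satisfying
   the norm axioms. *)

Definition dotv (R : realType) (d : nat) (x y : 'rV[R]_d) : R :=
  \sum_(k < d) x 0 k * y 0 k.

Record is_norm (R : realType) (d : nat) (N : 'rV[R]_d -> R) : Prop := IsNorm {
  is_norm_triangle : forall x y, N (x + y) <= N x + N y;
  is_norm_homog : forall (a : R) x, N (a *: x) = `|a| * N x;
  is_norm_eq0 : forall x, N x = 0 -> x = 0 }.

(* The supremum is attained, hence is the maximum, when 0 < d; for d = 0 the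
   set is empty and [sup set0 = 0]. *)
Definition dual_norm (R : realType) (d : nat) (N : 'rV[R]_d -> R)
    (x : 'rV[R]_d) : R :=
  sup [set dotv x y | y in [set y | N y = 1]].

Definition is_argmin (R : realType) (d : nat) (K : set 'rV[R]_d)
    (f : 'rV[R]_d -> R) (x : 'rV[R]_d) : Prop :=
  K x /\ forall y, K y -> f x <= f y.

(* Subgradient inequality tested against the points of D; D = setT is the usual
   notion.  The gradient at x of a differentiable function that is convex on a
   convex set D containing x satisfies it. *)
Definition is_subgradient (R : realType) (d : nat) (D : set 'rV[R]_d)
    (f : 'rV[R]_d -> R) (x g : 'rV[R]_d) : Prop :=
  forall y, D y -> f x + dotv g (y - x) <= f y.

Definition lipschitz_wrt (R : realType) (d : nat) (N : 'rV[R]_d -> R)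
    (K : set 'rV[R]_d) (G : R) (f : 'rV[R]_d -> R) : Prop :=
  0 <= G /\ forall x y, K x -> K y -> `|f x - f y| <= G * N (x - y).

(* The chosen (sub)gradient map of omega is the explicit argument gomega. *)
Definition bregman (R : realType) (d : nat) (omega : 'rV[R]_d -> R)
    (gomega : 'rV[R]_d -> 'rV[R]_d) (x y : 'rV[R]_d) : R :=
  omega x - omega y - dotv (gomega y) (x - y).

Definition doubly_stochastic (R : realType) (m : nat) (A : 'M[R]_m) : Prop :=
  [/\ forall i j, 0 <= A i j,
      forall i, \sum_(j < m) A i j = 1
    & forall j, \sum_(i < m) A i j = 1].

(* Edges are ordered pairs: A is not assumed to have a symmetric support. *)
Definition net_edge (R : realType) (m : nat) (A : 'M[R]_m) : rel 'I_m :=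
  fun i j => 0 < A i j.

Definition union_edge (R : realType) (m : nat) (P : nat -> 'M[R]_m)
    (B k : nat) : rel 'I_m :=
  fun i j => [exists s : 'I_B, net_edge (P (k * B + s.+1)%N) i j].

Definition strongly_connected (m : nat) (e : rel 'I_m) : Prop :=
  forall i j, connect e i j.

Record network_assumption (R : realType) (m : nat) (P : nat -> 'M[R]_m)
    (zeta : R) (B : nat) : Prop := NetworkAssumption {
  net_stochastic : forall t, (1 <= t)%N -> doubly_stochastic (P t);
  net_zeta_gt0 : 0 < zeta;
  net_diag : forall t i, (1 <= t)%N -> zeta <= P t i i;
  net_weight : forall t i j, (1 <= t)%N ->
    net_edge (P t) i j -> zeta <= P t i j;
  net_B_gt0 : (1 <= B)%N;
  net_connected : forall k, strongly_connected (union_edge P B k) }.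

Definition bounded_diameter (R : realType) (d : nat) (N : 'rV[R]_d -> R)
    (K : set 'rV[R]_d) (DK : R) : Prop :=
  forall x y, K x -> K y -> N (x - y) <= DK.

(* gl i t is the (sub)gradient map of the loss l i t.  The dual norm bound is
   part of the assumption: at boundary points of K it does not follow from the
   Lipschitz property over K. *)
Record loss_assumption (R : realType) (m d T : nat) (N : 'rV[R]_d -> R)
    (K : set 'rV[R]_d) (l : 'I_m -> nat -> 'rV[R]_d -> R)
    (gl : 'I_m -> nat -> 'rV[R]_d -> 'rV[R]_d) (r : 'rV[R]_d -> R)
    (Gl Gr : R) : Prop := LossAssumption {
  loss_lipschitz : forall i t, (1 <= t <= T)%N -> lipschitz_wrt N K Gl (l i t);
  loss_grad_bound : forall i t x, (1 <= t <= T)%N -> K x ->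
    dual_norm N (gl i t x) <= Gl;
  reg_lipschitz : lipschitz_wrt N K Gr r }.

Record mirror_assumption (R : realType) (d : nat) (N : 'rV[R]_d -> R)
    (K : set 'rV[R]_d) (omega : 'rV[R]_d -> R)
    (gomega : 'rV[R]_d -> 'rV[R]_d) (sigma Gomega : R) : Prop :=
  MirrorAssumption {
  mirror_sigma_gt0 : 0 < sigma;
  mirror_strongly_convex : forall x y, K x -> K y ->
    omega y + dotv (gomega y) (x - y) + sigma / 2 * N (x - y) ^+ 2 <= omega x;
  mirror_G_ge0 : 0 <= Gomega;
  mirror_smooth : forall x y, K x -> K y ->
    dual_norm N (gomega x - gomega y) <= Gomega * N (x - y) }.

Definition bregman_convex_snd (R : realType) (d : nat) (K : set 'rV[R]_d)
    (omega : 'rV[R]_d -> R) (gomega : 'rV[R]_d -> 'rV[R]_d) : Prop :=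
  forall x, K x ->
  forall (n : nat) (alpha : 'I_n -> R) (y : 'I_n -> 'rV[R]_d),
    (forall k, 0 <= alpha k) -> \sum_(k < n) alpha k = 1 ->
    (forall k, K (y k)) ->
    bregman omega gomega x (\sum_(k < n) alpha k *: y k)
      <= \sum_(k < n) alpha k * bregman omega gomega x (y k).

(* F_{i,t} of the algorithm, for the received gradient g and current iterate xc *)
Definition odcmd_objective (R : realType) (d : nat) (r omega : 'rV[R]_d -> R)
    (gomega : 'rV[R]_d -> 'rV[R]_d) (eta : R) (g xc x : 'rV[R]_d) : R :=
  dotv g x + r x + eta^-1 * bregman omega gomega x xc.

(* Runs of the algorithm, as a relation between the iterates x, the exact
   minimizers ystar and the approximate solutions y. *)
Record odcmd_run (R : realType) (m d T : nat) (K : set 'rV[R]_d)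
    (gl : 'I_m -> nat -> 'rV[R]_d -> 'rV[R]_d) (r omega : 'rV[R]_d -> R)
    (gomega : 'rV[R]_d -> 'rV[R]_d) (P : nat -> 'M[R]_m)
    (eta : R) (rho : nat -> R)
    (x ystar y : 'I_m -> nat -> 'rV[R]_d) : Prop := OdcmdRun {
  odcmd_init : forall i, is_argmin K omega (x i 1%N);
  odcmd_ystar : forall i t, (1 <= t <= T)%N ->
    is_argmin K
      (odcmd_objective r omega gomega eta (gl i t (x i t)) (x i t))
      (ystar i t);
  odcmd_y_in : forall i t, (1 <= t <= T)%N -> K (y i t);
  odcmd_y_approx : forall i t, (1 <= t <= T)%N ->
    odcmd_objective r omega gomega eta (gl i t (x i t)) (x i t) (y i t)
    <= odcmd_objective r omega gomega eta (gl i t (x i t)) (x i t) (ystar i t)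
       + rho t;
  odcmd_mix : forall i t, (1 <= t <= T)%N ->
    x i t.+1 = \sum_(j < m) P t i j *: y j t }.

Definition total_loss (R : realType) (m d T : nat)
    (l : 'I_m -> nat -> 'rV[R]_d -> R) (r : 'rV[R]_d -> R)
    (x : 'rV[R]_d) : R :=
  \sum_(1 <= t < T.+1) \sum_(j < m) (l j t x + r x).

Definition avg_regret (R : realType) (m d T : nat)
    (l : 'I_m -> nat -> 'rV[R]_d -> R) (r : 'rV[R]_d -> R)
    (x : 'I_m -> nat -> 'rV[R]_d) (xstar : 'rV[R]_d) (i : 'I_m) : R :=
  T%:R^-1 * \sum_(1 <= t < T.+1) \sum_(j < m) (l j t (x i t) + r (x i t))
  - T%:R^-1 * \sum_(1 <= t < T.+1) \sum_(j < m) (l j t xstar + r xstar).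

(* Main.v *)
Require Import Defs.
From HB Require Import structures.
From mathcomp Require Import all_boot all_order all_algebra.
From mathcomp Require Import all_classical all_reals all_analysis.
From mathcomp Require Import ring lra.

Set Implicit Arguments.
Unset Strict Implicit.
Unset Printing Implicit Defensive.

Import Order.TTheory GRing.Theory Num.Theory.

Local Open Scope classical_set_scope.
Local Open Scope ring_scope.

(** The regret of node j splits into two parts.  Comparing each loss at the
    iterate of node j with the same loss at the iterate of the node that owns
    it costs at most (Gl + Gr) times the distance between the two iterates;
    what remains is a sum of regrets of ordinary composite mirror descent
    steps.

    Mirror descent part.  The first-order condition at the exact minimizer
    ([mirror_step_optimality]) and the three-point identity bound the regret of
    a step by a difference of Bregman divergences plus a term of order eta
    ([mirror_step_regret]).  The same condition gives the step objective
    quadratic growth around its minimizer, so that a rho-approximate solution is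
    within sqrt(2 eta rho / sigma) of it ([approx_argmin_dist]).  Averaging with
    a doubly stochastic matrix does not increase the sum over the nodes of the
    divergences from the comparator, by convexity in the second argument
    ([run_bregman_mixing]), hence these differences telescope in time.

    Network part.  All nodes start at the same point, because a strongly convex
    function has one minimizer, so the iterates of two nodes differ only
    through the earlier moves, propagated by products of the mixing matrices
    ([mixing_expansion]).  Bounding each entry of such a product by a geometric
    sequence would lose a factor m, since a row has m entries; the stated
    constant requires a bound on the l1 distance between two rows, summed over
    time.  By duality with sign vectors this is a question about the oscillation
    of A z for a vector z.  The Lyapunov function is the sum over d of the sum
      of
    the d largest entries of z.  If a doubly stochastic matrix with diagonal at
    least zeta has an edge across the cut below the d largest entries, then the
    sum of the d largest entries drops by at least zeta times the gap at this
    cut ([topsum_mulmx_crosses]).  Over a window in which the graph is connected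
    every cut is crossed, and the gaps add up to the oscillation
    ([potential_window]).  Since the Lyapunov function varies by at most
    (m - 1)^2 oscillations, about 2 (m - 1)^2 / zeta windows halve the
    oscillation ([osc_halved]), and the row distances have sum at most
    8 m^2 B / zeta.  Bernoulli's inequality shows that
    2 theta / (1 - kappa) is at least this number ([network_constant_ge]). *)

(** * Sums of the largest entries *)

Section TopSums.
Variables (R : realType) (m : nat).
Implicit Types (z : 'cV[R]_m) (A : 'M[R]_m) (S : {set 'I_m}).

Definition osc z : R := \big[Num.max/0]_(p : 'I_m * 'I_m) (z p.1 0 - z p.2 0).

Lemma ge_osc z i k : z i 0 - z k 0 <= osc z.
Proof. exact: (le_bigmax 0 (fun p : 'I_m * 'I_m =>
  z p.1 0 - z p.2 0) (i, k)). Qed.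

Lemma osc_ge0 z : 0 <= osc z.
Proof. by apply/bigmax_geP; left. Qed.

Lemma osc_le z c :
  0 <= c -> (forall i k, z i 0 - z k 0 <= c) -> osc z <= c.
Proof. by move=> c0 zc; apply/bigmax_leP; split => // -[i k] _; exact: zc. Qed.

Definition decr_order z : seq 'I_m :=
  sort (fun i k => z k 0 <= z i 0) (enum 'I_m).

(** The list is padded with 0: [level z d] is meaningful for d < m only. *)
Definition level z (d : nat) : R := [seq z i 0 | i <- decr_order z]`_d.

Definition top (d : nat) z : {set 'I_m} := [set i in take d (decr_order z)].

Definition topsum (d : nat) z : R := \sum_(i in top d z) z i 0.

Lemma decr_order_uniq z : uniq (decr_order z).
Proof. by rewrite sort_uniq enum_uniq. Qed.

Lemma size_decr_order z : size (decr_order z) = m.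
Proof. by rewrite size_sort size_enum_ord. Qed.

Lemma mem_decr_order z i : i \in decr_order z.
Proof. by rewrite mem_sort mem_enum. Qed.

Lemma card_top d z : (d <= m)%N -> #|top d z| = d.
Proof.
move=> dm; rewrite cardsE; have /card_uniqP -> : uniq (take d (decr_order z)).
  by rewrite take_uniq// decr_order_uniq.
by rewrite size_takel// size_decr_order.
Qed.

Lemma in_top d z i : (i \in top d z) = (index i (decr_order z) < d)%N.
Proof. by rewrite inE in_take// mem_decr_order. Qed.

Lemma level_index z i : level z (index i (decr_order z)) = z i 0.
Proof.
have iz : (index i (decr_order z) < size (decr_order z))%N.
  by rewrite index_mem mem_decr_order.
by rewrite /level (nth_map i)// nth_index// mem_decr_order.
Qed.

Lemma level_anti z a b : (a <= b < m)%N -> level z b <= level z a.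
Proof.
move=> /andP[ab bm].
have srt : sorted >=%R [seq z i 0 | i <- decr_order z].
  rewrite sorted_map; apply: sort_sorted => i k; exact: le_total.
have tr : transitive (>=%R : rel R) by move=> x y w yx /le_trans; apply.
by apply: (sorted_leq_nth tr (@lexx _ _) 0 srt); rewrite // inE size_map
  size_decr_order// (leq_ltn_trans ab).
Qed.

Lemma index_order_lt z i : (index i (decr_order z) < m)%N.
Proof. by rewrite -[ltnRHS](size_decr_order z) index_mem mem_decr_order. Qed.

Lemma level_le_top d z i :
  (d < m)%N -> i \in top d.+1 z -> level z d <= z i 0.
Proof.
by move=> dm; rewrite in_top ltnS => id; rewrite -level_index level_anti// id.
Qed.

Lemma le_level_notin_top d z i : i \notin top d z -> z i 0 <= level z d.
Proof.
rewrite in_top -leqNgt => di.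
by rewrite -level_index level_anti// di index_order_lt.
Qed.

(** The gaps telescope to the largest entry minus the smallest one. *)
Lemma osc_le_gaps z :
  osc z <= \sum_(0 <= d < m.-1) (level z d - level z d.+1).
Proof.
rewrite (eq_bigr (fun d => - (level z d.+1 - level z d))); last first.
  by move=> d _; rewrite opprB.
rewrite sumrN telescope_sumr// opprB; apply: osc_le.
  rewrite subr_ge0; have [m0|m0] := posnP m;
    last by rewrite level_anti//= prednK.
  by rewrite (_ : m.-1 = 0%N)// m0.
move=> i k; apply: lerB.
  by apply: le_level_notin_top; rewrite in_top.
have m0 : (0 < m)%N by apply: leq_ltn_trans (ltn_ord i).
by apply: level_le_top; rewrite ?prednK// in_top index_order_lt.
Qed.

(** Moving weight [w k] from S, where z is at least a, to an index outside S,
    where z is at most b, loses at least a - b per unit of weight. *)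
Lemma weighted_sum_le (w : 'I_m -> R) S z a b :
    (forall k, 0 <= w k <= 1) -> \sum_k w k = #|S|%:R ->
    (forall i, i \in S -> a <= z i 0) ->
    (forall k, k \notin S -> z k 0 <= b) ->
  \sum_k w k * z k 0
    <= \sum_(i in S) z i 0 - (a - b) * \sum_(k | k \notin S) w k.
Proof.
move=> w01 wS zS zNS.
set al := \sum_(k | _) w k.
have alE : \sum_(i in S) (1 - w i) = al.
  rewrite sumrB sumr_const -wS (bigID (mem S))/= -/al; ring.
rewrite (bigID (mem S))/=.
have le1 : \sum_(i in S) w i * z i 0 <= \sum_(i in S) z i 0 - a * al.
  rewrite -alE mulr_sumr -sumrB ler_sum// => i iS.
  by have /andP[w0 w1] := w01 i; have := zS i iS; nra.
have le2 : \sum_(k | k \notin S) w k * z k 0 <= b * al.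
  rewrite mulr_sumr ler_sum// => k kS.
  by have /andP[w0 w1] := w01 k; have := zNS k kS; nra.
by lra.
Qed.

Definition mixing (zeta : R) A : Prop :=
  [/\ doubly_stochastic A, forall i, zeta <= A i i
    & forall i k, 0 < A i k -> zeta <= A i k].

Definition crosses A S : bool :=
  [exists i in S, [exists k in ~: S, 0 < A i k]].

Lemma col_sum_weights A S : doubly_stochastic A ->
  (forall k, 0 <= \sum_(i in S) A i k <= 1) /\
  \sum_k \sum_(i in S) A i k = #|S|%:R.
Proof.
move=> [A0 Ar Ac]; split=> [k|].
  rewrite sumr_ge0//= -(Ac k) [leRHS](bigID (mem S))/= lerDl sumr_ge0//.
rewrite exchange_big/= (eq_bigr (fun=> 1)); last by move=> i _; exact: Ar.
by rewrite sumr_const.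
Qed.

Lemma sum_mulmx A S z : \sum_(i in S) (A *m z) i 0 =
  \sum_k (\sum_(i in S) A i k) * z k 0.
Proof.
rewrite (eq_bigr (fun i => \sum_k A i k * z k 0)); last by move=> i _;
  rewrite mxE.
by rewrite exchange_big/=; apply: eq_bigr => k _; rewrite mulr_suml.
Qed.

(** A sum of d entries of A z is a combination of the entries of z with weights
    in [0, 1] of total d, so [weighted_sum_le] applies. *)
Lemma topsum_mulmx_le A S z a b : doubly_stochastic A -> b <= a ->
    (forall i, i \in S -> a <= z i 0) -> (forall k, k \notin S -> z k 0 <= b) ->
  topsum #|S| (A *m z) <= \sum_(i in S) z i 0.
Proof.
move=> dsA ba zS zNS; rewrite /topsum sum_mulmx.
set T := top _ _; have [w01 wS] := col_sum_weights T dsA.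
have cT : #|T| = #|S| by rewrite card_top// -[leqRHS]card_ord max_card.
rewrite cT in wS.
apply: (le_trans (weighted_sum_le w01 wS zS zNS)).
rewrite gerBl mulr_ge0 ?subr_ge0// sumr_ge0// => k _.
by have /andP[] := w01 k.
Qed.

(** For the set T of the d largest entries of A z, the weight that leaves S is at
    least zeta: if T = S it contains the entry of A on a crossing edge, and
    otherwise T has an index k outside S, whose diagonal entry counts. *)
Lemma topsum_mulmx_crosses zeta A S z a b : mixing zeta A -> b <= a ->
    crosses A S ->
    (forall i, i \in S -> a <= z i 0) -> (forall k, k \notin S -> z k 0 <= b) ->
  topsum #|S| (A *m z) <= \sum_(i in S) z i 0 - zeta * (a - b).
Proof.
move=> [dsA Ad Az] ba /exists_inP[i iS /exists_inP[k kS Aik]] zS zNS.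
rewrite /topsum sum_mulmx.
set T := top _ _; have [w01 wS] := col_sum_weights T dsA.
have cT : #|T| = #|S| by rewrite card_top// -[leqRHS]card_ord max_card.
rewrite cT in wS.
apply: (le_trans (weighted_sum_le w01 wS zS zNS)).
rewrite lerB// mulrC ler_wpM2l ?subr_ge0//.
have [A0 _ _] := dsA.
have wge k' i' : k' \notin S -> i' \in T -> A i' k' <=
    \sum_(k | k \notin S) \sum_(i in T) A i k.
  move=> k'S i'T; rewrite (bigD1 k')//= (bigD1 i')//= -addrA lerDl.
  by rewrite addr_ge0 ?sumr_ge0// => ? _; rewrite ?sumr_ge0.
have [TS|] := boolP (T \subset S).
  have /eqP TE : T == S by rewrite eqEcard TS cT/=.
  by apply: le_trans (wge k i _ _); rewrite ?TE ?Az//; move: kS; rewrite inE.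
by move=> /subsetPn[k' k'T k'S]; apply: le_trans (wge k' k' _ _).
Qed.

(** Column sums force the block of A from the complement into S to vanish as soon
    as the block from S to its complement does, so A then averages inside S and
    inside its complement separately. *)
Lemma mulmx_not_crosses A S z a b : doubly_stochastic A -> ~~ crosses A S ->
    (forall i, i \in S -> a <= z i 0) -> (forall k, k \notin S -> z k 0 <= b) ->
  [/\ \sum_(i in S) (A *m z) i 0 = \sum_(i in S) z i 0,
      forall i, i \in S -> a <= (A *m z) i 0
    & forall k, k \notin S -> (A *m z) k 0 <= b].
Proof.
move=> [A0 Ar Ac] ncr zS zNS.
have AN i k : i \in S -> k \notin S -> A i k = 0.
  move=> iS kS; apply/eqP; rewrite eq_le A0 andbT leNgt.
  apply: contra ncr => Aik; apply/exists_inP; exists i => //.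
  by apply/exists_inP; exists k => //; rewrite inE.
have colS k : k \in S -> \sum_(i in S) A i k = 1.
  move=> kS.
  have le1 k' : k' \in S -> \sum_(i in S) A i k' <= 1.
    by move=> _; have [/(_ k')/andP[]] := col_sum_weights S (And3 A0 Ar Ac).
  have sumS : \sum_(k in S) (1 - \sum_(i in S) A i k) = 0.
    rewrite sumrB exchange_big/= [X in _ - X](eq_bigr (fun=> 1)) ?subrr//.
    move=> i iS; rewrite -(Ar i) [RHS](bigID (mem S))/= [X in _ + X]big1
      ?addr0//.
    by move=> k' k'S; rewrite AN.
  apply/esym/eqP; rewrite -subr_eq0.
  have /eqP := sumS; rewrite psumr_eq0; last by move=> k' /le1;
    rewrite subr_ge0.
  by move=> /allP/(_ k); rewrite mem_index_enum kS => /(_ isT).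
have AN' i k : i \notin S -> k \in S -> A i k = 0.
  move=> iS kS; have := Ac k; rewrite (bigID (mem S))/= colS//.
  move=> /eqP; rewrite -subr_eq0 addrAC subrr add0r psumr_eq0//.
  by move=> /allP/(_ i); rewrite mem_index_enum iS => /(_ isT)/eqP.
split=> [|i iS|k kS].
- rewrite sum_mulmx [LHS](bigID (mem S))/= [X in _ + X]big1 ?addr0.
    by apply: eq_bigr => k kS; rewrite colS// mul1r.
  by move=> k kS; rewrite big1 ?mul0r// => i iS; exact: AN.
- rewrite mxE -[a]mul1r -(Ar i) mulr_suml ler_sum// => k _.
  by have [kS|kS] := boolP (k \in S);
    [rewrite ler_wpM2l ?zS | rewrite AN// !mul0r].
- rewrite mxE -[b]mul1r -(Ar k) mulr_suml ler_sum// => i _.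
  by have [iS|iS] := boolP (i \in S);
    [rewrite AN'// !mul0r | rewrite ler_wpM2l ?zNS].
Qed.

Lemma osc_mulmx A z : doubly_stochastic A -> osc (A *m z) <= osc z.
Proof.
move=> [A0 Ar Ac]; apply: osc_le (osc_ge0 z) _ => i k.
have zle l : \sum_(j < m) A i j * z j 0 <= z l 0 + osc z.
  rewrite -[leRHS]mul1r -(Ar i) mulr_suml ler_sum// => j _.
  by rewrite ler_wpM2l// -lerBlDl ge_osc.
rewrite !mxE lerBlDl -[osc z]mul1r -(Ar k) mulr_suml -big_split/=.
rewrite -[leLHS]mul1r -(Ar k) mulr_suml ler_sum// => l _.
by rewrite -mulrDr ler_wpM2l.
Qed.

End TopSums.

(** * Products of averaging matrices *)

Section Products.
Variables (R : realType) (m : nat).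
Implicit Types (z : 'cV[R]_m) (A : 'M[R]_m) (S : {set 'I_m}).

Lemma topsum_nonincreasing A d z : doubly_stochastic A -> (d < m)%N ->
  topsum d.+1 (A *m z) <= topsum d.+1 z.
Proof.
move=> dsA dm; have cT := card_top z dm.
rewrite -{1}cT (@topsum_mulmx_le _ _ _ _ _ (level z d) (level z d))// => i.
  exact: level_le_top.
move=> iN; apply: le_level_notin_top; apply: contra iN; rewrite !in_top.
exact: leq_trans.
Qed.

Lemma doubly_stochastic1 : doubly_stochastic (1%:M : 'M[R]_m).
Proof.
split=> [i k|i|k]; first by rewrite mxE; case: eqP.
  by rewrite (bigD1 i)//= big1 ?mxE ?eqxx ?addr0// => k ki;
    rewrite mxE eq_sym (negPf ki).
by rewrite (bigD1 k)//= big1 ?mxE ?eqxx ?addr0// => i ki;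
  rewrite mxE (negPf ki).
Qed.

Lemma doubly_stochastic_mul A A' : doubly_stochastic A ->
  doubly_stochastic A' -> doubly_stochastic (A *m A').
Proof.
move=> [A0 Ar Ac] [A'0 A'r A'c]; split=> [i k|i|k].
- by rewrite mxE sumr_ge0// => l _; rewrite mulr_ge0.
- under eq_bigr do rewrite mxE.
  rewrite exchange_big/= -[RHS](Ar i); apply: eq_bigr => l _.
  by rewrite -mulr_sumr A'r mulr1.
- under eq_bigr do rewrite mxE.
  rewrite exchange_big/= -[RHS](A'c k); apply: eq_bigr => l _.
  by rewrite -mulr_suml Ac mul1r.
Qed.

(** The latest round is the leftmost factor.  The recursion peels off the earliest
    round, as the window argument follows a vector forward in time. *)
Fixpoint wprod (P : nat -> 'M[R]_m) (t n : nat) : 'M[R]_m :=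
  if n is n'.+1 then wprod P t.+1 n' *m P t else 1%:M.

Lemma wprodD P t a b : wprod P t (a + b) = wprod P (t + a) b *m wprod P t a.
Proof.
elim: a t => [|a IH] t /=; first by rewrite addn0 mulmx1.
by rewrite IH addSnnS mulmxA.
Qed.

Lemma wprodSr P t n : wprod P t n.+1 = P (t + n)%N *m wprod P t n.
Proof. by rewrite -addn1 wprodD/= mul1mx. Qed.

Lemma wprod_doubly_stochastic P t n :
  (forall s, (1 <= s)%N -> doubly_stochastic (P s)) -> (1 <= t)%N ->
  doubly_stochastic (wprod P t n).
Proof.
move=> Pds; elim: n t => [|n IH] t t1 /=; first exact: doubly_stochastic1.
by apply: doubly_stochastic_mul; [exact: IH | exact: Pds].
Qed.

Section Window.
Variables (P : nat -> 'M[R]_m) (zeta : R).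
Hypothesis Pmix : forall s, (1 <= s)%N -> mixing zeta (P s).
Let Pds s : (1 <= s)%N -> doubly_stochastic (P s).
Proof. by move=> /Pmix[]. Qed.

(** Until the first crossing of the cut, both sides are averaged separately and
    the separation of S from its complement by a and b persists; the first
    crossing then gains zeta (a - b), and later steps do not increase the sum. *)
Lemma topsum_window_cut t n S z a b : (1 <= t)%N -> b <= a ->
    (forall i, i \in S -> a <= z i 0) -> (forall k, k \notin S -> z k 0 <= b) ->
    (exists2 s, (s < n)%N & crosses (P (t + s)) S) ->
  topsum #|S| (wprod P t n *m z) <= \sum_(i in S) z i 0 - zeta * (a - b).
Proof.
move=> + ba; elim: n t z => [|n IH] t z t1 zS zNS [s sn cr]; first by [].
rewrite /= -mulmxA; have [crt|ncr] := boolP (crosses (P t) S).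
  apply: le_trans (topsum_mulmx_crosses (Pmix t1) ba crt zS zNS).
  have /exists_inP[i iS _] := crt.
  have : (0 < #|S|)%N by apply/card_gt0P; exists i.
  have : (#|S| <= m)%N by rewrite -[leqRHS]card_ord max_card.
  case: #|S| => // d dm _.
  by apply: topsum_nonincreasing => //; exact: wprod_doubly_stochastic.
have [<- zS' zNS'] := mulmx_not_crosses (Pds t1) ncr zS zNS.
apply: IH => //; case: s sn cr => [|s] sn cr.
  by rewrite addn0 (negPf ncr) in cr.
by exists s; rewrite // addSnnS.
Qed.

Variable B : nat.
Hypothesis Pconn : forall k, strongly_connected (union_edge P B k).

(** A path of the union graph that leaves S uses an edge of some round of the
    window. *)
Lemma connected_crosses k S i l : i \in S -> l \notin S ->
  exists2 s, (s < B)%N & crosses (P ((k * B).+1 + s)%N) S.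
Proof.
move=> iS lS; have /connectP[p pth lE] := Pconn k i l.
elim: p i iS pth lE => [|j p IH] i iS /=; first by move=> _ lE; rewrite lE iS in lS.
move=> /andP[/existsP[s Pij] pth] lE.
have [jS|jS] := boolP (j \in S); first exact: IH jS pth lE.
exists s => //; apply/exists_inP; exists i => //; apply/exists_inP; exists j.
  by rewrite inE.
by rewrite addSnnS.
Qed.

Definition potential z : R := \sum_(0 <= d < m.-1) topsum d.+1 z.

(** Each cut between consecutive levels is crossed during the window and gains
    zeta times its gap; the gains for different cuts affect different terms of
    the potential, so they add up even if they come from the same round. *)
Lemma potential_window k z : 0 <= zeta ->
  potential (wprod P (k * B).+1 B *m z) <= potential z - zeta * osc z.
Proof.
move=> zeta0; apply: (@le_trans _ _ (potential z -
    zeta * \sum_(0 <= d < m.-1) (level z d - level z d.+1))); last first.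
  by rewrite lerB// ler_wpM2l// osc_le_gaps.
rewrite mulr_sumr -sumrB ler_sum_nat// => d /andP[_ dm].
have m0 : (0 < m)%N by case: (m) dm.
have dm' : (d.+1 < m)%N by rewrite -(prednK m0) ltnS.
have cT := card_top z (ltnW dm').
rewrite -{1}cT; apply: topsum_window_cut => //.
- by rewrite level_anti// leqnSn.
- by move=> i; apply: level_le_top; exact: ltnW.
- by move=> i; exact: le_level_notin_top.
have /card_gt0P[i iT] : (0 < #|top d.+1 z|)%N by rewrite cT.
have /card_gt0P[l] : (0 < #|~: top d.+1 z|)%N.
  by rewrite cardsCs finset.setCK card_ord cT subn_gt0.
by rewrite inE => lT; exact: connected_crosses iT lT.
Qed.

(** The d largest entries of z exceed any d entries of A z by at most d
    oscillations, since the entries of A z are at least the minimum of z. *)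
Lemma potential_diff_le A z : doubly_stochastic A ->
  potential z - potential (A *m z) <= (m.-1 ^ 2)%:R * osc z.
Proof.
move=> dsA; have [m0|m0] := posnP m.
  rewrite /potential !big_geq ?m0// subrr mulr_ge0 ?osc_ge0//.
rewrite -sumrB; apply: (@le_trans _ _ (\sum_(0 <= d < m.-1) m.-1%:R * osc z)).
  rewrite ler_sum_nat// => d /andP[_ dm].
  have dm' : (d.+1 <= m)%N by rewrite -(prednK m0) ltnS ltnW.
  have [l lmin] : exists l, forall i, z l 0 <= z i 0.
    case: (arg_minP (fun i => z i 0) (isT : xpredT (Ordinal m0))) => l _ lP.
    by exists l => i; exact: lP.
  have hi : topsum d.+1 z <= \sum_(i in top d.+1 z) (z l 0 + osc z).
    by rewrite ler_sum// => i _; rewrite -lerBlDl ge_osc.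
  have lo : \sum_(i in top d.+1 (A *m z)) z l 0 <= topsum d.+1 (A *m z).
    rewrite ler_sum// => i _; have [A0 Ar _] := dsA.
    by rewrite mxE -[leLHS]mul1r -(Ar i) mulr_suml ler_sum// => j _;
      rewrite ler_wpM2l.
  move: hi lo; rewrite !sumr_const !card_top//
    mulrnDl -(mulr_natl (osc z)) => hi lo.
  have : d.+1%:R * osc z <= m.-1%:R * osc z by rewrite ler_wpM2r ?osc_ge0//
    ler_nat.
  by lra.
by rewrite sumr_const_nat subn0 -mulrnAl -mulrnA mulnn.
Qed.

Lemma potential_windows k q z : 0 <= zeta ->
  zeta * q%:R * osc (wprod P (k * B).+1 (q * B) *m z)
    <= potential z - potential (wprod P (k * B).+1 (q * B) *m z).
Proof.
move=> zeta0; elim: q => [|q IH];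
  first by rewrite mul0n/= mul1mx mulr0 mul0r subrr.
rewrite mulSnr wprodD addSn -mulnDl -mulmxA.
set z' := wprod _ _ _ *m z in IH *.
have drop := potential_window (k + q) z' zeta0.
have mono : osc (wprod P ((k + q) * B).+1 B *m z') <= osc z'.
  by apply: osc_mulmx; exact: wprod_doubly_stochastic.
have : zeta * q.+1%:R * osc (wprod P ((k + q) * B).+1 B *m z') <=
       zeta * q%:R * osc z' + zeta * osc z'.
  rewrite -mulrDl -[X in _ <= (_ + X) * _]mulr1 -mulrDr natr1.
  by rewrite ler_wpM2l// mulr_ge0.
by lra.
Qed.

(** The extra window accounts for the rounds before the first window that starts
    after round t and for those left over at the end.
    During the q full windows the potential drops by at least q zeta times the
    final oscillation, and at most by (m - 1)^2 times the initial one. *)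
Lemma osc_halved t q z : 0 < zeta -> (0 < B)%N -> (1 <= t)%N ->
    (0 < q)%N -> 2 * (m.-1 ^ 2)%:R <= zeta * q%:R ->
  osc (wprod P t (q.+1 * B) *m z) <= osc z / 2.
Proof.
move=> zeta0 B0 t1 q0 mq.
have [k [r [rB kr]]] : exists k r, (r <= B)%N /\ (t + r = (k * B).+1)%N.
  have := divn_eq t.-1 B; have := ltn_pmod t.-1 B0.
  move: (t.-1 %/ B)%N (t.-1 %% B)%N => a b bB tE.
  exists a.+1, (B - b)%N; split; first exact: leq_subr.
  by rewrite -(prednK t1) tE addSn mulSnr -addnA subnKC// ltnW.
have -> : (q.+1 * B = r + (q * B + (B - r)))%N.
  by rewrite addnCA subnKC// mulSnr.
rewrite !wprodD kr -!mulmxA; set z1 := wprod P t r *m z.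
set z2 := wprod _ _ (q * B) *m z1.
have ds := wprod_doubly_stochastic _ Pds.
have osc1 : osc z1 <= osc z by apply/osc_mulmx/ds.
have osc3 : osc (wprod P ((k * B).+1 + q * B) (B - r) *m z2) <= osc z2.
  exact/osc_mulmx/ds.
have win := potential_windows k q z1 (ltW zeta0).
have pot := potential_diff_le z1 (ds (k * B).+1 (q * B)%N isT).
have zq0 : 0 < zeta * q%:R by rewrite mulr_gt0// ltr0n.
have le2 : zeta * q%:R * osc z2 <= zeta * q%:R * (osc z1 / 2).
  apply: (le_trans (le_trans win pot)).
  have := osc_ge0 z1; nra.
rewrite ler_pM2l// in le2.
by lra.
Qed.

(** The l1 distance of two rows of A A' is the difference of two entries of
    A (A' s) for a sign vector s, so contraction of the oscillation by A is
    inherited by row distances. *)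
Lemma rowdist_mulmx A A' c e : 0 <= c -> 0 <= e ->
    (forall z, osc (A *m z) <= c * osc z) ->
    (forall i k, \sum_l `|A' i l - A' k l| <= e) ->
  forall i k, \sum_l `|(A *m A') i l - (A *m A') k l| <= c * e.
Proof.
move=> c0 e0 Ac A'e i k.
pose s := \col_l Num.sg ((A *m A') i l - (A *m A') k l).
have -> : \sum_l `|(A *m A') i l - (A *m A') k l| =
    (A *m (A' *m s)) i 0 - (A *m (A' *m s)) k 0.
  rewrite mulmxA mxE [X in _ - X]mxE -sumrB; apply: eq_bigr => l _.
  by rewrite [s l 0]mxE -mulrBl mulrC -normrEsg.
apply: (le_trans (ge_osc _ _ _)); apply: (le_trans (Ac _)).
rewrite ler_wpM2l//; apply: osc_le => // i' k'; apply: le_trans (A'e i' k').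
rewrite mxE [X in _ - X]mxE -sumrB ler_sum// => l _.
rewrite -mulrBl (le_trans (ler_norm _))// normrM ler_piMr// mxE normr_sg.
by case: (_ == _).
Qed.

Lemma rowdist_doubly_stochastic A i k : doubly_stochastic A ->
  \sum_l `|A i l - A k l| <= 2.
Proof.
move=> [A0 Ar _]; apply: (@le_trans _ _ (\sum_l (A i l + A k l))).
  apply: ler_sum => l _; rewrite (le_trans (ler_normB _ _))//.
  by rewrite !ger0_norm.
by rewrite big_split/= !Ar.
Qed.

Lemma rowdist_wprod H t n i k : (0 < H)%N -> (1 <= t)%N ->
    (forall s z, (1 <= s)%N -> osc (wprod P s H *m z) <= osc z / 2) ->
  \sum_l `|wprod P t n i l - wprod P t n k l| <= 2 * 2^-1 ^+ (n %/ H).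
Proof.
move=> H0 t1 half; rewrite [in leLHS](divn_eq n H).
elim: (n %/ H)%N i k => [|a IH] i k.
  rewrite expr0 mulr1; apply: rowdist_doubly_stochastic.
  exact: wprod_doubly_stochastic.
rewrite mulSn -addnA addnC wprodD exprS mulrCA; apply: rowdist_mulmx => //.
  by move=> z; rewrite mulrC half// ltn_addr.
Qed.

End Window.
End Products.

(** The terms are constant on blocks of length H and halve from one block to the
    next. *)
Lemma sum_geometric_blocks (R : realFieldType) (H N : nat) : (0 < H)%N ->
  \sum_(0 <= n < N) 2 * 2^-1 ^+ (n %/ H) <= 4 * H%:R :> R.
Proof.
move=> H0.
have sumQ Q : \sum_(0 <= n < Q * H) 2 * 2^-1 ^+ (n %/ H) =
    4 * H%:R * (1 - 2^-1 ^+ Q) :> R.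
  elim: Q => [|Q IH]; first by rewrite mul0n big_geq// expr0 subrr mulr0.
  rewrite (@big_cat_nat _ _ _ (Q * H))//= ?leq_mul2r ?leqnSn ?orbT// IH.
  rewrite (eq_big_nat _ _ (F2 := fun=> 2 * 2^-1 ^+ Q)); last first.
    move=> n /andP[Qn nQ]; congr (2 * 2^-1 ^+ _).
    by apply/eqP; rewrite eqn_leq leq_divRL// Qn andbT -ltnS ltn_divLR.
  by rewrite sumr_const_nat -mulnBl subSnn mul1n -mulr_natr exprS; field.
apply: (@le_trans _ _ (\sum_(0 <= n < N * H) 2 * 2^-1 ^+ (n %/ H))).
  rewrite [leRHS](@big_cat_nat _ _ _ N)//= ?leq_pmulr// lerDl.
  by rewrite sumr_ge0// => n _; rewrite mulr_ge0// exprn_ge0// invr_ge0.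
by rewrite sumQ ler_piMr ?mulr_ge0// gerBl exprn_ge0// invr_ge0.
Qed.

(** With b = 1 - delta and kappa^B = b, Bernoulli's inequality for 1 / kappa gives
    B (1 - kappa) <= delta / b, and 1 / b <= b^-2. *)
Lemma network_constant_ge (R : realType) (m B : nat) (zeta : R)
    (b : R := 1 - zeta / (4 * m%:R ^+ 2)) :
    (0 < m)%N -> (0 < B)%N -> 0 < zeta <= 1 ->
  8 * m%:R ^+ 2 * B%:R / zeta <= 2 * b ^- 2 / (1 - b `^ (B%:R^-1)).
Proof.
move=> m0 B0 /andP[z0 z1]; set kappa := b `^ _.
have m1 : 1 <= m%:R ^+ 2 :> R by rewrite exprn_ege1// ler1n.
have mp : 0 < 4 * m%:R ^+ 2 :> R by rewrite mulr_gt0//; lra.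
pose dl := zeta / (4 * m%:R ^+ 2); have bE : b = 1 - dl by [].
have dl0 : 0 < dl by rewrite divr_gt0.
have dl1 : dl <= 4^-1 by rewrite ler_pdivrMr// mulrA mulVf//
  mul1r (le_trans z1).
have b0 : 0 < b by rewrite bE; lra.
have b1 : b < 1 by rewrite bE; lra.
have Bp : 0 < B%:R :> R by rewrite ltr0n.
have k0 : 0 < kappa by rewrite powR_gt0.
have kB : kappa ^+ B = b.
  by rewrite -powR_mulrn ?ltW// -powRrM mulVf ?gt_eqF// powRr1// ltW.
have k1 : kappa < 1.
  by rewrite ltNge; apply/negP => /(exprn_ege1 B); rewrite kB leNgt b1.
have bern : 1 + B%:R * (1 - kappa) <= kappa ^- B.
  rewrite -exprVn; have : 1 + (1 - kappa) <= kappa^-1.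
    by rewrite -(ler_pM2l k0) mulfV ?gt_eqF//; nra.
  set c := 1 - kappa => cV; have c0 : 0 <= c by rewrite subr_ge0 ltW.
  apply: (@le_trans _ _ ((1 + c) ^+ B)); last first.
    by rewrite lerXn2r ?nnegrE ?(addr_ge0 ler01 c0) ?invr_ge0 ?(ltW k0).
  elim: (B) => [|n IH]; first by rewrite mulr0n mul0r addr0 expr0.
  rewrite exprS -natr1; have n0 : 0 <= n%:R :> R by [].
  by apply: le_trans (ler_wpM2l _ IH); [nra | exact: addr_ge0].
rewrite kB in bern.
have bb : b * b^-1 = 1 by rewrite mulfV ?gt_eqF.
have key : B%:R * (1 - kappa) * b <= dl.
  have : (1 + B%:R * (1 - kappa)) * b <= b^-1 * b by rewrite ler_pM2r.
  by rewrite mulVf ?gt_eqF// mulrDl mul1r bE; lra.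
have -> : 8 * m%:R ^+ 2 * B%:R / zeta = 2 * B%:R / dl.
  by rewrite /dl; field; rewrite !gt_eqF// ltr0n.
rewrite ler_pdivrMr// mulrAC ler_pdivlMr ?subr_gt0//.
have : B%:R * (1 - kappa) <= b^-1 * dl.
  by rewrite [leRHS]mulrC ler_pdivlMr.
have bV : 1 <= b^-1 by rewrite invf_ge1// ltW.
have -> : b ^- 2 = b^-1 * b^-1 by rewrite -exprVn expr2.
move: (b^-1) bV => v v1 le1; have : v * dl <= v * v * dl.
  by rewrite -mulrA ler_peMl// mulr_ge0 ?(ltW dl0)// (le_trans ler01 v1).
by lra.
Qed.

(** * Accumulated disagreement between the nodes *)

Section Norms.
Variables (R : realType) (d : nat) (N : 'rV[R]_d -> R).
Hypothesis hN : is_norm N.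

Lemma norm0 : N 0 = 0.
Proof. by rewrite -(scale0r 0) (is_norm_homog hN) normr0 mul0r. Qed.

Lemma normN v : N (- v) = N v.
Proof. by rewrite -scaleN1r (is_norm_homog hN) normrN normr1 mul1r. Qed.

Lemma norm_ge0 v : 0 <= N v.
Proof.
have := is_norm_triangle hN v (- v); rewrite subrr norm0 normN.
by lra.
Qed.

Lemma norm_sum (I : Type) (s : seq I) (Q : pred I) (F : I -> 'rV[R]_d) :
  N (\sum_(i <- s | Q i) F i) <= \sum_(i <- s | Q i) N (F i).
Proof.
elim/big_ind2 : _ => [|v a w b va wb|//]; first by rewrite norm0.
by rewrite (le_trans (is_norm_triangle hN _ _))// lerD.
Qed.

Lemma normB v w : N (v - w) = N (w - v).
Proof. by rewrite -normN opprB. Qed.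

Lemma normB_trans v u w : N (v - w) <= N (v - u) + N (u - w).
Proof. by rewrite (le_trans _ (is_norm_triangle hN _ _))// addrA subrK. Qed.

End Norms.

Section Disagreement.
Variables (R : realType) (m d T : nat).
Implicit Types P : nat -> 'M[R]_m.

(** Writing Y t = X t + (Y t - X t), each move is propagated by the product of
    the later mixing matrices. *)
Lemma mixing_expansion P (X Y : nat -> 'M[R]_(m, d)) n :
    (forall t, (1 <= t <= T)%N -> X t.+1 = P t *m Y t) -> (n <= T)%N ->
  X n.+1 = wprod P 1 n *m X 1%N +
    \sum_(1 <= s < n.+1) wprod P s (n.+1 - s) *m (Y s - X s).
Proof.
move=> XY; elim: n => [|n IH] nT; first by rewrite big_geq// addr0 mul1mx.
rewrite XY ?nT// [in RHS]big_nat_recr//= subSnn /= mul1mx.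
set E := Y n.+1 - X n.+1.
have -> : P n.+1 *m Y n.+1 = P n.+1 *m X n.+1 + P n.+1 *m E.
  by rewrite -mulmxDr addrC subrK.
rewrite IH ?(ltnW nT)//
  mulmxDr mulmxA -{1}[n.+1]add1n -wprodSr addrA mulmx_sumr.
congr (_ + _ + _); apply: eq_big_nat => s /andP[s1 sn].
by rewrite mulmxA (subSn (ltnW sn)) wprodSr subnKC// ltnW.
Qed.

Variables (N : 'rV[R]_d -> R) (hN : is_norm N).

Lemma norm_row_diff_mulmx (A : 'M[R]_m) (M : 'M[R]_(m, d)) i k e :
    (forall l, N (row l M) <= e) ->
  N (row i (A *m M) - row k (A *m M)) <= (\sum_l `|A i l - A k l|) * e.
Proof.
move=> Me; rewrite !row_mul !mulmx_sum_row -sumrB mulr_suml.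
apply: (le_trans (norm_sum hN _ _ _)); apply: ler_sum => l _.
by rewrite !mxE -scalerBl (is_norm_homog hN) ler_wpM2l.
Qed.

Variables (P : nat -> 'M[R]_m) (zeta : R) (B : nat).
Hypothesis A1 : network_assumption P zeta B.

Let Pmix t : (1 <= t)%N -> mixing zeta (P t).
Proof.
move=> t1; split; first exact: (net_stochastic A1).
  by move=> i; exact: (net_diag A1).
by move=> i k; exact: (net_weight A1).
Qed.

Lemma net_zeta_le1 (i : 'I_m) : zeta <= 1.
Proof.
have [P0 Pr _] := net_stochastic A1 (leqnn 1).
rewrite (le_trans (net_diag A1 i (leqnn 1)))// -(Pr i) (bigD1 i)//= lerDl.
by rewrite sumr_ge0.
Qed.

(** The move made in round s contributes to the disagreement in round t at most
    its size times the l1 distance of two rows of the product from s to t - 1;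
    the common starting point contributes nothing, since rows have sum 1. *)
Lemma total_disagreement (x y : 'I_m -> nat -> 'rV[R]_d) (e : nat -> R) i k
    (b : R := 1 - zeta / (4 * m%:R ^+ 2)) :
    (forall i k, x i 1%N = x k 1%N) ->
    (forall i t, (1 <= t <= T)%N -> x i t.+1 = \sum_(l < m) P t i l *: y l t) ->
    (forall l s, (1 <= s <= T)%N -> N (y l s - x l s) <= e s) ->
  \sum_(1 <= t < T.+1) N (x i t - x k t) <=
  2 * b ^- 2 / (1 - b `^ (B%:R^-1)) * \sum_(1 <= s < T.+1) e s.
Proof.
move=> x1 xS ye.
have m0 : (0 < m)%N by apply: leq_ltn_trans (ltn_ord i).
have z0 : 0 < zeta := net_zeta_gt0 A1.
have B0 : (0 < B)%N := net_B_gt0 A1.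
have z1 := net_zeta_le1 i.
have e0 s : (1 <= s <= T)%N -> 0 <= e s.
  by move=> sT; exact: le_trans (norm_ge0 hN _) (ye i s sT).
(* q windows halve an oscillation, and H rounds contain q full windows. *)
pose w : R := 2 * (m.-1 ^ 2)%:R / zeta; pose q := (Num.truncn w).+1.
pose H := (q.+1 * B)%N.
have w0 : 0 <= w by rewrite divr_ge0 ?mulr_ge0// ltW.
have H0 : (0 < H)%N by rewrite muln_gt0.
have half s z : (1 <= s)%N -> osc (wprod P s H *m z) <= osc z / 2.
  move=> s1; apply: (osc_halved Pmix (net_connected A1)) => //.
  by rewrite [leRHS]mulrC -ler_pdivrMr// ltW// truncnS_gt.
pose g n : R := 2 * 2^-1 ^+ (n %/ H).
have g0 n : 0 <= g n by rewrite mulr_ge0// exprn_ge0// invr_ge0.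
pose X t := \matrix_l x l t; pose Y t := \matrix_l y l t.
have rX t l : row l (X t) = x l t by rewrite rowK.
have XY t : (1 <= t <= T)%N -> X t.+1 = P t *m Y t.
  move=> tT; apply/row_matrixP => l; rewrite rX xS// row_mul mulmx_sum_row.
  by apply: eq_bigr => l' _; rewrite mxE rowK.
have step t : (1 <= t < T.+1)%N -> N (x i t - x k t) <=
    \sum_(1 <= s < T.+1 | (s < t)%N) g (t - s)%N * e s.
  case: t => // n /andP[_]; rewrite ltnS => nT; have nT' := ltnW nT.
  rewrite -(@big_nat_widen _ _ _ 1 n.+1 T.+1 xpredT (fun s =>
    g (n.+1 - s)%N * e s)) ?ltnS//.
  rewrite -(rX _ i) -(rX _ k) (mixing_expansion XY) ?ltnS//
    !rowE !mulmxDr -!rowE.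
  have -> : row i (wprod P 1 n *m X 1%N) = row k (wprod P 1 n *m X 1%N).
    have [_ Wr _] : doubly_stochastic (wprod P 1 n).
      by apply: wprod_doubly_stochastic => // s /Pmix[].
    have Wx j : row j (wprod P 1 n *m X 1%N) = x i 1%N.
      rewrite row_mul mulmx_sum_row -[RHS]scale1r -(Wr j) scaler_suml.
      by apply: eq_bigr => l _; rewrite mxE rX (x1 l i).
    by rewrite !Wx.
  rewrite opprD addrACA subrr add0r !rowE !mulmx_sumr -sumrB;
    apply: (le_trans (norm_sum hN _ _ _)).
  apply: ler_sum_nat => s /andP[s1 sn].
  have sT : (1 <= s <= T)%N by rewrite s1 ltnW// (leq_trans sn).
  have Ye l : N (row l (Y s - X s)) <= e s by rewrite rowE mulmxBr -!rowE !rowK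
    ye.
  rewrite -!rowE; apply: (le_trans (norm_row_diff_mulmx _ _ _ Ye)).
  by rewrite ler_wpM2r ?e0//; exact: (rowdist_wprod Pmix).
have sumg : \sum_(1 <= t < T.+1) N (x i t - x k t) <=
    4 * H%:R * \sum_(1 <= s < T.+1) e s.
  apply: (le_trans (ler_sum_nat step)).
  rewrite (exchange_big_dep_nat xpredT)//= mulr_sumr;
    apply: ler_sum_nat => s /andP[s1 sT].
  rewrite -mulr_suml ler_wpM2r ?e0 ?s1//.
  rewrite -(@big_nat_widenl _ _ _ s.+1 1 T.+1 xpredT (fun t => g (t - s)%N))//.
  rewrite -[s.+1]add0n big_addn subSS.
  apply: le_trans (sum_geometric_blocks R (T - s).+1 H0).
  rewrite [leRHS]big_nat_recl//= -[leLHS]add0r lerD//.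
  by apply: ler_sum_nat => n _; rewrite -addSnnS addnK.
apply: (le_trans sumg); rewrite ler_wpM2r//.
  by rewrite big_nat; apply: sumr_ge0 => s; exact: e0.
apply: le_trans (network_constant_ge m0 B0 _); last by rewrite z0.
have qw : q%:R <= w + 1 by rewrite -natr1 lerD2r truncn_le.
have -> : 8 * m%:R ^+ 2 * B%:R / zeta = 4 * (2 * m%:R ^+ 2 / zeta * B%:R) by
  ring.
rewrite ler_pM2l// natrM ler_pM2r ?ltr0n// -natr1.
apply: (@le_trans _ _ (w + 2)); first by lra.
rewrite -(ler_pM2r z0) mulrDl /w !divfK ?gt_eqF//.
have -> : m%:R = m.-1%:R + 1 :> R by rewrite natr1 prednK.
by rewrite natrX; have : 0 <= m.-1%:R :> R by []; nra.
Qed.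

End Disagreement.

(** * The dual norm *)

Section DualNorm.
Import numFieldNormedType.Exports.
Variables (R : realType) (d : nat).
Implicit Types a b u v : 'rV[R]_d.

Lemma dotvDr a u v : dotv a (u + v) = dotv a u + dotv a v.
Proof. by rewrite -big_split; apply: eq_bigr => k _; rewrite mxE mulrDr. Qed.

Lemma dotvZr a c v : dotv a (c *: v) = c * dotv a v.
Proof. by rewrite mulr_sumr; apply: eq_bigr => k _; rewrite mxE mulrCA. Qed.

Lemma dotvC a b : dotv a b = dotv b a.
Proof. by apply: eq_bigr => k _; rewrite mulrC. Qed.

Lemma dotvBr a u v : dotv a (u - v) = dotv a u - dotv a v.
Proof. by rewrite dotvDr -scaleN1r dotvZr mulN1r. Qed.

Lemma dotvBl u v a : dotv (u - v) a = dotv u a - dotv v a.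
Proof. by rewrite dotvC dotvBr !(dotvC a). Qed.

Lemma coord_le_norm v k : `|v 0 k| <= `|v|.
Proof.
rewrite [leRHS]/Num.Def.normr/= mx_normrE.
exact: (le_bigmax 0 (fun i : 'I_1 * 'I_d => `|v i.1 i.2|) (0, k)).
Qed.

Variable N : 'rV[R]_d -> R.
Hypothesis hN : is_norm N.

(** The norm is Lipschitz for the sup norm, with the sum of the norms of the unit
    vectors as constant. *)
Lemma is_norm_continuous : continuous N.
Proof.
pose M := \sum_k N (delta_mx 0 k).
have M0 : 0 <= M by apply: sumr_ge0 => k _; exact: norm_ge0.
have NM v : N v <= M * `|v|.
  rewrite [in leLHS](row_sum_delta v); apply: (le_trans (norm_sum hN _ _ _)).
  rewrite mulr_suml; apply: ler_sum => k _.
  by rewrite (is_norm_homog hN) mulrC ler_wpM2l ?norm_ge0 ?coord_le_norm.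
have NB u v : `|N u - N v| <= M * `|u - v|.
  apply: le_trans (NM (u - v)); rewrite ler_norml; apply/andP; split.
    by have := normB_trans hN v u 0; rewrite !subr0 (normB hN v u); lra.
  by have := normB_trans hN u v 0; rewrite !subr0; lra.
move=> v; apply/(@cvgrPdist_le _ _ _ (nbhs v) (nbhs_filter v)) => e e0.
near=> u; apply: (le_trans (NB v u)).
apply: (@le_trans _ _ ((M + 1) * `|v - u|)).
  by rewrite ler_wpM2r// lerDl.
rewrite mulrC -ler_pdivlMr; last by rewrite ltr_wpDl.
near: u; apply/nbhs_ballP; exists (e / (M + 1)).
  by rewrite /= divr_gt0// ltr_wpDl.
by move=> u; rewrite -ball_normE /= => /ltW.
Unshelve. all: by end_near. Qed.

(** The norm has a positive minimum on the compact unit sphere of the sup norm. *)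
Lemma sup_norm_le : exists c, forall v, `|v| <= c * N v.
Proof.
pose S := [set v : 'rV[R]_d | `|v| = 1].
have [S0|S0] := pselect (S !=set0); last first.
  exists 0 => v; rewrite mul0r; have [->|v0] := eqVneq v 0;
    first by rewrite normr0.
  exfalso; apply: S0; exists (`|v|^-1 *: v).
  by rewrite /S/= normrZ normfV normr_id mulVf// normr_eq0.
have cS : compact S.
  apply: bounded_closed_compact.
    by exists 1; split=> [|M M1 v /= ->]; [exact: real1 | exact: ltW].
  have -> : S = (fun v : 'rV[R]_d => `|v|) @^-1` [set 1] by [].
  apply: closed_comp => [v _|]; [exact: norm_continuous | exact: closed_eq].
have [v0 Sv0 v0min] : exists2 c, c \in S & forall t, t \in S -> N c <= N t.
  by apply: EVT_min_rV => //; apply: continuous_subspaceT;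
    exact: is_norm_continuous.
have Nv0 : 0 < N v0.
  rewrite lt_neqAle norm_ge0// andbT eq_sym; apply/eqP => /(is_norm_eq0 hN) v00.
  by move: Sv0; rewrite inE /S/= v00 normr0 => /esym/eqP; rewrite oner_eq0.
exists (N v0)^-1 => v; have [->|v_neq0] := eqVneq v 0.
  by rewrite normr0 (norm0 hN) mulr0.
have vp : 0 < `|v| by rewrite normr_gt0.
have := v0min (`|v|^-1 *: v); rewrite inE /S/= normrZ normfV normr_id.
rewrite mulVf ?gt_eqF// => /(_ erefl);
  rewrite (is_norm_homog hN) normfV normr_id.
by rewrite ler_pdivlMl// mulrC ler_pdivlMl.
Qed.

(** The supremum that defines the dual norm is taken over a bounded set by
    [sup_norm_le]; the inequality is then homogeneous in v. *)
Lemma dotv_le_dual a v : dotv a v <= dual_norm N a * N v.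
Proof.
have [/(is_norm_eq0 hN) ->|Nv] := eqVneq (N v) 0.
  by rewrite (norm0 hN) mulr0 /dotv big1// => k _; rewrite mxE mulr0.
have Nv0 : 0 < N v by rewrite lt_neqAle eq_sym Nv norm_ge0.
rewrite -ler_pdivrMr// mulrC -dotvZr; apply: ub_le_sup; last first.
  exists ((N v)^-1 *: v) => //=.
  by rewrite (is_norm_homog hN) normfV ger0_norm ?norm_ge0// mulVf.
have [c cN] := sup_norm_le.
exists ((\sum_k `|a 0 k|) * c) => _ [u /= Nu <-].
rewrite mulr_suml; apply: ler_sum => k _.
rewrite (le_trans (ler_norm _))// normrM ler_wpM2l//.
by rewrite (le_trans (coord_le_norm u k))// (le_trans (cN u))// Nu mulr1.
Qed.

End DualNorm.

(** * Convexity along segments *)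

Section Convexity.
Variables (R : realType) (d : nat) (K : set 'rV[R]_d).

Lemma segmentE (u v : 'rV[R]_d) s :
  u + s *: (v - u) = s *: v + (1 - s) *: u.
Proof. by apply/rowP => k; rewrite !mxE; ring. Qed.

Lemma convex_set_segment : convex_set (M := 'rV[R]_d) K ->
  forall u v s, K u -> K v -> 0 <= s <= 1 -> K (u + s *: (v - u)).
Proof.
move=> hK u v s Ku Kv /andP[s0 s1]; rewrite segmentE.
by have := hK v u (Itv01 s0 s1); rewrite !inE; apply.
Qed.

Lemma convex_function_segment (f : 'rV[R]_d -> R) :
    convex_function (E := 'rV[R]_d) setT f ->
  forall u v s, 0 <= s <= 1 -> f (u + s *: (v - u)) <= f u + s * (f v - f u).
Proof.
move=> hf u v s /andP[s0 s1].
have -> : f u + s * (f v - f u) = s * f v + (1 - s) * f u by ring.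
by rewrite segmentE; have := hf (Itv01 s0 s1) v u; rewrite !inE; apply.
Qed.

(** Normalizing by the total weight lets an induction peel off the last point:
    the remaining weights need not have sum 1. *)
Lemma convex_set_sum : convex_set (M := 'rV[R]_d) K ->
  forall n (a : 'I_n -> R) (v : 'I_n -> 'rV[R]_d),
    (forall i, 0 <= a i) -> \sum_i a i = 1 -> (forall i, K (v i)) ->
  K (\sum_i a i *: v i).
Proof.
move=> hK n a v a0 a1 Kv.
suff : forall k (b : 'I_k -> R) (w : 'I_k -> 'rV[R]_d), (forall i, 0 <= b i) ->
    (forall i, K (w i)) -> 0 < \sum_i b i ->
    K ((\sum_i b i)^-1 *: \sum_i b i *: w i).
  by move=> /(_ n a v a0 Kv); rewrite a1 invr1 scale1r; apply.
elim=> [|k IH] b w b0 Kw; first by rewrite big_ord0 ltxx.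
rewrite !big_ord_recr/=; set s := \sum_i _; set c := b ord_max => sc.
have s0 : 0 <= s by apply: sumr_ge0.
have c0 : 0 <= c by exact: b0.
have [sE|sN] := eqVneq s 0.
  have bE i : b (widen_ord (leqnSn k) i) = 0.
    have /eqP := sE; rewrite psumr_eq0// => /allP/(_ i).
    by rewrite mem_index_enum => /(_ isT)/eqP.
  rewrite big1 ?add0r => [|i _]; last by rewrite bE scale0r.
  rewrite sE add0r in sc *.
  by rewrite scalerA mulVf ?scale1r ?gt_eqF.
have sp : 0 < s by rewrite lt_neqAle eq_sym sN.
set q := \sum_i _.
have Kq : K (s^-1 *: q) by apply: IH.
have -> : (s + c)^-1 *: (q + c *: w ord_max) =
    s^-1 *: q + (c / (s + c)) *: (w ord_max - s^-1 *: q).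
  by apply/rowP => k'; rewrite !mxE; field; rewrite sN gt_eqF.
apply: convex_set_segment => //.
apply/andP; split; first by rewrite divr_ge0// ltW.
by rewrite ler_pdivrMr// mul1r lerDr ltW.
Qed.

End Convexity.

(** * One approximate mirror descent step *)

Section MirrorStep.
Variables (R : realType) (d : nat) (N : 'rV[R]_d -> R) (K : set 'rV[R]_d).
Variables (r omega : 'rV[R]_d -> R) (gomega : 'rV[R]_d -> 'rV[R]_d).
Variables (Gl Gr sigma Gomega eta : R).
Hypotheses (hN : is_norm N) (hK : convex_set (M := 'rV[R]_d) K).
Hypothesis hr : convex_function (E := 'rV[R]_d) setT r.
Hypothesis hgomega : forall x, K x -> is_subgradient K omega x (gomega x).
Hypothesis A4 : mirror_assumption N K omega gomega sigma Gomega.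
Hypothesis eta_gt0 : 0 < eta.
Local Notation V := (bregman omega gomega).
Local Notation F := (odcmd_objective r omega gomega eta).
Let sigma_gt0 : 0 < sigma := mirror_sigma_gt0 A4.

Lemma three_point x y w :
  dotv (gomega y - gomega w) (x - y) = V x w - V x y - V y w.
Proof. by rewrite /bregman dotvBl !dotvBr; ring. Qed.

Lemma bregman_ge x y : K x -> K y -> sigma / 2 * N (x - y) ^+ 2 <= V x y.
Proof. by move=> Kx Ky; have := mirror_strongly_convex A4 Kx Ky;
  rewrite /bregman; lra. Qed.

Lemma bregman_ge0 x y : K x -> K y -> 0 <= V x y.
Proof.
move=> Kx Ky; apply: le_trans (bregman_ge Kx Ky).
by rewrite mulr_ge0 ?sqr_ge0// divr_ge0// ltW.
Qed.

(** This is the limit s -> 0, without limits: if a < 0, then s = -a / (c - a)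
    gives a contradiction. *)
Lemma ge0_of_linear_error (a c : R) : 0 <= c ->
  (forall s, 0 < s <= 1 -> 0 <= a + s * c) -> 0 <= a.
Proof.
move=> c0 ac; rewrite leNgt; apply/negP => a0.
have ca : 0 < c - a by lra.
have /ac : 0 < - a / (c - a) <= 1.
  by rewrite divr_gt0 ?oppr_gt0//= ler_pdivrMr// mul1r; lra.
rewrite -(pmulr_rge0 _ ca) mulrDr mulrA mulrCA mulfV ?gt_eqF//.
by nra.
Qed.

(** The mirror map is not assumed differentiable, only equipped with a map of
    subgradients that is Lipschitz on K.  Moving from the minimizer ys towards x
    by s, the subgradient inequality at the new point replaces the derivative,
    and the Lipschitz bound makes the error of order s^2. *)
Lemma mirror_step_optimality g w ys x : K w -> is_argmin K (F g w) ys -> K x ->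
  0 <= dotv g (x - ys) + r x - r ys
       + eta^-1 * dotv (gomega ys - gomega w) (x - ys).
Proof.
move=> Kw [Kys ysmin] Kx.
have Ge := mirror_G_ge0 A4.
apply: (@ge0_of_linear_error _ (eta^-1 * (Gomega * N (x - ys) ^+ 2))).
  by apply: mulr_ge0; [rewrite invr_ge0 ltW | rewrite mulr_ge0 ?sqr_ge0].
move=> s /andP[s0 s1]; have s01 : 0 <= s <= 1 by rewrite ltW.
have Kz := convex_set_segment hK Kys Kx s01.
have rz := convex_function_segment hr ys x s01.
set z := ys + s *: (x - ys) in Kz rz.
have zys : z - ys = s *: (x - ys) by rewrite addrAC subrr add0r.
have := ysmin z Kz.
have oz := hgomega Kz Kys.
have gz : dotv (gomega z - gomega ys) (x - ys) <= s * (Gomega * N (x - ys) ^+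
  2).
  apply: (le_trans (dotv_le_dual hN _ _)).
  apply: (@le_trans _ _ (Gomega * N (z - ys) * N (x - ys))).
    by rewrite ler_wpM2r ?norm_ge0//; exact: (mirror_smooth A4).
  by rewrite zys (is_norm_homog hN) ger0_norm ?(ltW s0)//; lra.
have zE u : dotv u z = dotv u ys + s * dotv u (x - ys).
  by rewrite /z dotvDr dotvZr.
have dV : V z w - V ys w <=
    s * (dotv (gomega ys - gomega w) (x - ys) + s * (Gomega * N (x - ys) ^+ 2)).
  move: oz; rewrite -[ys - z]opprB zys -scaleNr dotvZr => oz.
  have := ler_wpM2l (ltW s0) gz.
  rewrite /bregman !dotvBl !(dotvBr _ _ w) zE; lra.
have e0 : 0 <= eta^-1 by rewrite invr_ge0 ltW.
have := ler_wpM2l e0 dV; rewrite /odcmd_objective zE => eV le0.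
rewrite -(pmulr_rge0 _ s0).
by lra.
Qed.

(** Strong convexity is applied at the midpoint of two minimizers. *)
Lemma argmin_mirror_unique u v :
  is_argmin K omega u -> is_argmin K omega v -> u = v.
Proof.
move=> [Ku umin] [Kv vmin]; apply/eqP; rewrite eq_sym -subr_eq0.
apply/eqP/(is_norm_eq0 hN)/eqP; rewrite -sqrf_eq0 eq_le sqr_ge0 andbT.
have h01 : 0 <= (2^-1 : R) <= 1 by lra.
have Kz := convex_set_segment hK Ku Kv h01; set z := u + _ in Kz.
have uz : u - z = (- 2^-1) *: (v - u).
  by rewrite /z opprD addrA subrr add0r scaleNr.
have vz : v - z = 2^-1 *: (v - u).
  by apply/rowP => k; rewrite !mxE; field.
have := mirror_strongly_convex A4 Ku Kz.
have := mirror_strongly_convex A4 Kv Kz.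
rewrite uz vz !dotvZr !(is_norm_homog hN) normrN (ger0_norm (x := 2^-1))//.
have := umin _ Kz; have := vmin _ Kz; move=> vz' uz' e1 e2.
have : sigma * N (v - u) ^+ 2 <= 0 by lra.
by rewrite pmulr_rle0// sigma_gt0.
Qed.

Hypothesis r_lip : lipschitz_wrt N K Gr r.

(** Optimality tested at the centre w: the divergences in the two directions are each
    at least sigma / 2 times the squared distance, while the linear terms are at
    most Gl + Gr times the distance. *)
Lemma mirror_step_move g w ys : 0 <= Gl -> dual_norm N g <= Gl -> K w ->
  is_argmin K (F g w) ys -> N (ys - w) <= eta * (Gl + Gr) / sigma.
Proof.
move=> Gl0 gG Kw ysmin; have [Kys _] := ysmin; have Gr0 := r_lip.1.
have := mirror_step_optimality Kw ysmin Kw; rewrite three_point.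
have V0 : V w w = 0 by rewrite /bregman dotvBr; ring.
have V1 := bregman_ge Kw Kys; have V2 := bregman_ge Kys Kw.
have lr := r_lip.2 w ys Kw Kys; have := ler_norm (r w - r ys).
have gN := dotv_le_dual hN g (w - ys).
rewrite (normB hN ys w) V0 in V1 V2 *; move: lr gN V1 V2.
have := norm_ge0 hN (w - ys); move: (N _) => n n0 lr gN V1 V2 rn opt.
have gn : dual_norm N g * n <= Gl * n by rewrite ler_wpM2r.
have e0 : 0 < eta^-1 by rewrite invr_gt0.
have eV : eta^-1 * (0 - V w ys - V ys w) <= eta^-1 * - (sigma * n ^+ 2).
  by rewrite ler_pM2l//; lra.
have : eta^-1 * (sigma * n ^+ 2) <= (Gl + Gr) * n by lra.
rewrite ler_pdivrMl// ler_pdivlMr// => le2.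
have [->|nn] := eqVneq n 0.
  by rewrite mul0r; apply: mulr_ge0; rewrite ?addr_ge0// ltW.
have np : 0 < n by rewrite lt_neqAle eq_sym nn.
by rewrite -(ler_pM2r np); lra.
Qed.

(** By optimality the objective exceeds its minimum by at least V(y, ys) / eta. *)
Lemma approx_argmin_dist g w ys y rho : K w -> is_argmin K (F g w) ys -> K y ->
    0 <= rho -> F g w y <= F g w ys + rho ->
  N (y - ys) <= Num.sqrt (2 / sigma) * Num.sqrt (eta * rho).
Proof.
move=> Kw ysmin Ky rho0 yrho; have [Kys _] := ysmin.
have opt := mirror_step_optimality Kw ysmin Ky; rewrite three_point in opt.
have VN := bregman_ge Ky Kys.
have e0 : 0 < eta^-1 by rewrite invr_gt0.
have Vrho : eta^-1 * V y ys <= rho.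
  by move: opt yrho; rewrite /odcmd_objective dotvBr; lra.
have V2 : V y ys <= eta * rho by rewrite -ler_pdivrMl.
have s2 : 0 <= 2 / sigma by rewrite divr_ge0// ltW.
rewrite -sqrtrM// -(ger0_norm (norm_ge0 hN _)) -sqrtr_sqr.
rewrite ler_sqrt; last by rewrite mulr_ge0// mulr_ge0// ltW.
rewrite -(ler_pM2l sigma_gt0).
have -> : sigma * (2 / sigma * (eta * rho)) = 2 * (eta * rho).
  by field; rewrite gt_eqF.
by lra.
Qed.

(** The term - V(ys, w) / eta from the three-point identity absorbs the linear
    cost (Gl + Gr) N(w - ys) of moving from w to ys.  Replacing ys by y in the
    divergence from xs costs at most Gomega DK N(y - ys). *)
Lemma mirror_step_regret DK g w ys y xs rho : bounded_diameter N K DK ->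
    0 <= Gl -> dual_norm N g <= Gl -> K w -> is_argmin K (F g w) ys -> K y ->
    0 <= rho -> F g w y <= F g w ys + rho -> K xs ->
  dotv g (w - xs) + r w - r xs <= eta^-1 * (V xs w - V xs y)
    + eta * (Gl + Gr) ^+ 2 / (2 * sigma)
    + Num.sqrt (2 / sigma) * Gomega * DK * Num.sqrt (rho / eta).
Proof.
move=> hDK Gl0 gG Kw ysmin Ky rho0 yrho Kxs; have [Kys _] := ysmin.
have e0 : 0 < eta^-1 by rewrite invr_gt0.
have opt := mirror_step_optimality Kw ysmin Kxs; rewrite three_point in opt.
have dist := approx_argmin_dist Kw ysmin Ky rho0 yrho.
have Vy : V xs y - V xs ys <=
    Gomega * DK * (Num.sqrt (2 / sigma) * Num.sqrt (eta * rho)).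
  have -> : V xs y - V xs ys = dotv (gomega ys - gomega y) (xs - y) - V y ys.
    by rewrite /bregman dotvBl !dotvBr; ring.
  have := bregman_ge0 Ky Kys.
  have : dotv (gomega ys - gomega y) (xs - y) <=
      Gomega * DK * (Num.sqrt (2 / sigma) * Num.sqrt (eta * rho)).
    apply: (le_trans (dotv_le_dual hN _ _)).
    apply: (@le_trans _ _ (Gomega * N (ys - y) * N (xs - y))).
      by rewrite ler_wpM2r ?norm_ge0//; exact: (mirror_smooth A4).
    have Ge := mirror_G_ge0 A4.
    apply: (@le_trans _ _ (Gomega * N (ys - y) * DK)).
      by rewrite ler_wpM2l ?hDK// mulr_ge0// norm_ge0.
    rewrite mulrAC ler_wpM2l ?(normB hN ys)//.
    by rewrite mulr_ge0// (le_trans _ (hDK w w Kw Kw))// norm_ge0.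
  by lra.
have sqrtE : eta^-1 * Num.sqrt (eta * rho) = Num.sqrt (rho / eta).
  have -> : eta * rho = eta ^+ 2 * (rho / eta) by field; rewrite gt_eqF.
  by rewrite sqrtrM ?sqr_ge0// sqrtr_sqr ger0_norm ?(ltW eta_gt0)//
    mulKf ?gt_eqF.
have eVy := ler_wpM2l (ltW e0) Vy.
have gN := le_trans (dotv_le_dual hN g (w - ys)) (ler_wpM2r (norm_ge0 hN _) gG).
have lr := r_lip.2 w ys Kw Kys; have rw := ler_norm (r w - r ys).
have Vw := ler_wpM2l (ltW e0) (bregman_ge Kys Kw).
rewrite (normB hN ys w) in Vw.
have sq : (Gl + Gr) * N (w - ys) - eta^-1 * (sigma / 2 * N (w - ys) ^+ 2) <=
    eta * (Gl + Gr) ^+ 2 / (2 * sigma).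
  rewrite -subr_ge0; set n := N _; set G := Gl + Gr.
  have -> : eta * G ^+ 2 / (2 * sigma) - (G * n - eta^-1 * (sigma / 2 * n ^+ 2))
     = eta / (2 * sigma) * (G - sigma / eta * n) ^+ 2.
    by field; rewrite !gt_eqF.
  by rewrite mulr_ge0 ?sqr_ge0//
    divr_ge0 ?mulr_ge0 ?(ltW eta_gt0) ?(ltW sigma_gt0).
rewrite -sqrtE.
move: gN opt eVy; rewrite !dotvBr; lra.
Qed.

End MirrorStep.

(** * Runs of the algorithm *)

Section Run.
Variables (R : realType) (m d T : nat).
Variables (N : 'rV[R]_d -> R) (K : set 'rV[R]_d).
Variables (l : 'I_m -> nat -> 'rV[R]_d -> R).
Variables (gl : 'I_m -> nat -> 'rV[R]_d -> 'rV[R]_d).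
Variables (r omega : 'rV[R]_d -> R) (gomega : 'rV[R]_d -> 'rV[R]_d).
Variables (P : nat -> 'M[R]_m) (zeta : R) (B : nat).
Variables (DK Gl Gr sigma Gomega eta : R) (rho : nat -> R).
Variables (x ystar y : 'I_m -> nat -> 'rV[R]_d).
Hypotheses (hN : is_norm N) (hK : convex_set (M := 'rV[R]_d) K).
Hypothesis hgl : forall i t x, (1 <= t <= T)%N -> K x ->
  is_subgradient setT (l i t) x (gl i t x).
Hypothesis hr : convex_function (E := 'rV[R]_d) setT r.
Hypothesis hgomega : forall x, K x -> is_subgradient K omega x (gomega x).
Hypotheses (A1 : network_assumption P zeta B) (A2 : bounded_diameter N K DK).
Hypothesis A3 : loss_assumption T N K l gl r Gl Gr.
Hypothesis A4 : mirror_assumption N K omega gomega sigma Gomega.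
Hypothesis A5 : bregman_convex_snd K omega gomega.
Hypothesis eta_gt0 : 0 < eta.
Hypothesis hrho : forall t, (1 <= t <= T)%N -> 0 <= rho t.
Hypothesis hrun : odcmd_run T K gl r omega gomega P eta rho x ystar y.

Lemma run_in_K i t : (1 <= t <= T.+1)%N -> K (x i t).
Proof.
case: t => [//|[|t]] tT; first by have [] := odcmd_init hrun i.
rewrite (odcmd_mix hrun)//;
  have [P0 Pr _] := net_stochastic A1 (isT : (0 < t.+1)%N).
by apply: convex_set_sum => // k; apply: (odcmd_y_in hrun).
Qed.

Lemma run_Gl_ge0 (i : 'I_m) t : (1 <= t <= T)%N -> 0 <= Gl.
Proof. by move=> tT; have [] := loss_lipschitz A3 i tT. Qed.

Local Notation moved t :=
  (eta * (Gl + Gr) / sigma + Num.sqrt (2 / sigma) * Num.sqrt (eta * rho t)).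

Lemma run_disagreement i k (b : R := 1 - zeta / (4 * m%:R ^+ 2)) :
  \sum_(1 <= t < T.+1) N (x i t - x k t) <=
  2 * b ^- 2 / (1 - b `^ (B%:R^-1)) * \sum_(1 <= t < T.+1) moved t.
Proof.
apply: (@total_disagreement _ _ _ T N hN P zeta B A1 x y (fun t =>
  moved t)) => //.
- move=> i' k'.
  by apply: (argmin_mirror_unique hN hK A4); exact: (odcmd_init hrun).
- by move=> i' t tT; rewrite (odcmd_mix hrun).
move=> i' t tT; have [t1 tT'] := andP tT.
have Kx : K (x i' t) by apply: run_in_K; rewrite t1 leqW.
have ysP := odcmd_ystar hrun i' tT.
apply: (le_trans (normB_trans hN _ (ystar i' t) _)); rewrite addrC; apply: lerD.
  apply: (mirror_step_move hN hK hr hgomega A4 eta_gt0 (reg_lipschitz A3) _ _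
    Kx ysP).
    exact: run_Gl_ge0 i' _ tT.
  exact: loss_grad_bound A3 _ _ _ tT Kx.
apply: (approx_argmin_dist hN hK hr hgomega A4 eta_gt0 Kx ysP) => //.
- exact: (odcmd_y_in hrun).
- exact: hrho.
exact: (odcmd_y_approx hrun).
Qed.

Local Notation V := (bregman omega gomega).

Lemma run_local_regret xs i t : (1 <= t <= T)%N -> K xs ->
  l i t (x i t) + r (x i t) - (l i t xs + r xs) <=
    eta^-1 * (V xs (x i t) - V xs (y i t))
    + eta * (Gl + Gr) ^+ 2 / (2 * sigma)
    + Num.sqrt (2 / sigma) * Gomega * DK * Num.sqrt (rho t / eta).
Proof.
move=> tT Kxs; have [t1 tT'] := andP tT.
have Kx : K (x i t) by apply: run_in_K; rewrite t1 leqW.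
have := hgl i tT Kx (I : [set: 'rV[R]_d] xs).
rewrite -[xs - _]opprB -scaleN1r dotvZr => sub.
have := @mirror_step_regret _ _ _ _ _ _ _ Gl Gr _ _ _ hN hK hr hgomega A4
  eta_gt0
  (reg_lipschitz A3) DK (gl i t (x i t)) (x i t) (ystar i t) (y i t) xs (rho t)
    A2
  (run_Gl_ge0 i tT) (loss_grad_bound A3 i tT Kx) Kx (odcmd_ystar hrun i tT)
  (odcmd_y_in hrun i tT) (hrho tT) (odcmd_y_approx hrun i tT) Kxs.
lra.
Qed.

(** Convexity in the second argument uses that the rows have sum 1, and the
    summation over the nodes that the columns have sum 1. *)
Lemma run_bregman_mixing xs t : (1 <= t <= T)%N -> K xs ->
  \sum_(i < m) V xs (x i t.+1) <= \sum_(i < m) V xs (y i t).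
Proof.
move=> tT Kxs; have [t1 tT'] := andP tT.
have [P0 Pr Pc] := net_stochastic A1 t1.
apply: (@le_trans _ _ (\sum_i \sum_k P t i k * V xs (y k t))).
  apply: ler_sum => i _; rewrite (odcmd_mix hrun)//.
  by apply: A5 => // k; exact: (odcmd_y_in hrun).
rewrite exchange_big/=; apply: ler_sum => k _.
by rewrite -mulr_suml Pc mul1r.
Qed.

(** The differences of divergences telescope, and the last divergence is
    nonnegative. *)
Lemma run_regret xs j (b : R := 1 - zeta / (4 * m%:R ^+ 2))
    (C : R := 2 * b ^- 2 / (1 - b `^ (B%:R^-1))) : (1 <= T)%N -> K xs ->
  \sum_(1 <= t < T.+1) \sum_(i < m) (l i t (x j t) + r (x j t))
  - \sum_(1 <= t < T.+1) \sum_(i < m) (l i t xs + r xs) <=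
    (Gl + Gr) * (m%:R * (C * \sum_(1 <= t < T.+1) moved t))
    + eta^-1 * \sum_(i < m) V xs (x i 1%N)
    + m%:R * \sum_(1 <= t < T.+1) (eta * (Gl + Gr) ^+ 2 / (2 * sigma)
       + Num.sqrt (2 / sigma) * Gomega * DK * Num.sqrt (rho t / eta)).
Proof.
move=> T1 Kxs; pose Phi t := \sum_(i < m) V xs (x i t).
pose err t := eta * (Gl + Gr) ^+ 2 / (2 * sigma)
       + Num.sqrt (2 / sigma) * Gomega * DK * Num.sqrt (rho t / eta).
have e0 : 0 <= eta^-1 by rewrite invr_ge0 ltW.
have step t : (1 <= t < T.+1)%N ->
    \sum_(i < m) (l i t (x j t) + r (x j t)) - \sum_(i < m) (l i t xs + r xs) <=
    (Gl + Gr) * \sum_(i < m) N (x j t - x i t) - eta^-1 * (Phi t.+1 - Phi t)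
    + m%:R * err t.
  move=> tT; have [t1 tT'] := andP tT.
  have Kx i : K (x i t) by apply: run_in_K; rewrite t1 ltnW.
  apply: (@le_trans _ _ ((Gl + Gr) * \sum_(i < m) N (x j t - x i t)
      + eta^-1 * (\sum_(i < m) V xs (x i t) - \sum_(i < m) V xs (y i t))
      + m%:R * err t)).
    rewrite mulr_natl -[m in _ *+ m]card_ord -sumr_const -!sumrB !mulr_sumr.
    rewrite -!big_split/=; apply: ler_sum => i _.
    have := run_local_regret i tT Kxs; rewrite /err.
    have := (loss_lipschitz A3 i tT).2 _ _ (Kx j) (Kx i).
    have := (reg_lipschitz A3).2 _ _ (Kx j) (Kx i).
    have := ler_norm (l i t (x j t) - l i t (x i t)).
    have := ler_norm (r (x j t) - r (x i t)).
    by lra.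
  have := ler_wpM2l e0 (run_bregman_mixing tT Kxs); rewrite /Phi.
  by lra.
rewrite -sumrB; apply: (le_trans (ler_sum_nat step)).
rewrite big_split/= sumrB -!mulr_sumr telescope_sumr// exchange_big/=.
have PhiT : 0 <= Phi T.+1.
  by apply: sumr_ge0 => i _; apply: (bregman_ge0 A4) => //; apply: run_in_K;
    rewrite /= leqnn.
apply: lerD => //; apply: lerD; last first.
  have := mulr_ge0 e0 PhiT; rewrite /Phi; lra.
have G0 : 0 <= Gl + Gr.
  by rewrite addr_ge0 ?(reg_lipschitz A3).1 ?(@run_Gl_ge0 j 1)// T1.
rewrite ler_wpM2l//.
apply: (@le_trans _ _ (\sum_(i < m) (C * \sum_(1 <= t < T.+1) moved t))).
  by apply: ler_sum => i _; exact: run_disagreement.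
by rewrite sumr_const card_ord [leRHS]mulr_natl.
Qed.

End Run.

Theorem theorem1 (R : realType) (m d T : nat) (hT : (1 <= T)%N)
    (N : 'rV[R]_d -> R) (hN : is_norm N)
    (K : set 'rV[R]_d) (hK : convex_set (M := 'rV[R]_d) K)
    (l : 'I_m -> nat -> 'rV[R]_d -> R)
    (hl : forall i t, (1 <= t <= T)%N ->
       convex_function (E := 'rV[R]_d) setT (l i t))
    (gl : 'I_m -> nat -> 'rV[R]_d -> 'rV[R]_d)
    (hgl : forall i t x, (1 <= t <= T)%N -> K x ->
       is_subgradient setT (l i t) x (gl i t x))
    (r : 'rV[R]_d -> R) (hr : convex_function (E := 'rV[R]_d) setT r)
    (omega : 'rV[R]_d -> R) (gomega : 'rV[R]_d -> 'rV[R]_d)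
    (hgomega : forall x, K x -> is_subgradient K omega x (gomega x))
    (P : nat -> 'M[R]_m) (zeta : R) (B : nat)
    (DK Gl Gr sigma Gomega : R)
    (A1 : network_assumption P zeta B)
    (A2 : bounded_diameter N K DK)
    (A3 : loss_assumption T N K l gl r Gl Gr)
    (A4 : mirror_assumption N K omega gomega sigma Gomega)
    (A5 : bregman_convex_snd K omega gomega)
    (xstar : 'rV[R]_d) (hxstar : is_argmin K (total_loss T l r) xstar)
    (eta : R) (heta : 0 < eta)
    (rho : nat -> R) (hrho : forall t, (1 <= t <= T)%N -> 0 <= rho t)
    (x ystar y : 'I_m -> nat -> 'rV[R]_d)
    (hrun : odcmd_run T K gl r omega gomega P eta rho x ystar y)
    (j : 'I_m) :
  let theta := (1 - zeta / (4 * m%:R ^+ 2)) ^- 2 in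
  let kappa := (1 - zeta / (4 * m%:R ^+ 2)) `^ (B%:R^-1) in
  let C := 2 * theta / (1 - kappa) in
  let a0 := C * (Gl + Gr) * \sum_(i < m) N (x i 1%N) in
  let a1 := \sum_(i < m) bregman omega gomega xstar (x i 1%N) in
  let a2 := m%:R / sigma *
    (2^-1 * Gl ^+ 2 + Gr * (Gl + Gr) + C * (Gl + Gr) ^+ 2) in
  let a3 := m%:R * Num.sqrt (2 / sigma) * (Gl + C * (Gl + Gr)) in
  let a4 := 2 * m%:R * Num.sqrt (2 / sigma) * Gomega * DK in
  avg_regret T l r x xstar j <=
    a0 / T%:R + a1 * (eta * T%:R)^-1 + a2 * eta
    + a3 / T%:R * \sum_(1 <= t < T.+1) Num.sqrt (eta * rho t)
    + a4 / T%:R * \sum_(1 <= t < T.+1) Num.sqrt (rho t / eta).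
Proof.
cbv zeta.
set C := 2 * _ / _.
have T0 : 0 < T%:R :> R by rewrite ltr0n.
have s0 := mirror_sigma_gt0 A4.
have [Kxs _] := hxstar.
have T1 : (1 <= 1 <= T)%N by rewrite hT.
have Gl0 := run_Gl_ge0 A3 j T1.
have Gr0 := (reg_lipschitz A3).1.
have m0 : (0 < m)%N by apply: leq_ltn_trans (ltn_ord j).
have C0 : 0 <= C.
  have z0 := net_zeta_gt0 A1.
  apply: le_trans (network_constant_ge m0 (net_B_gt0 A1) _); last first.
    by rewrite z0 (net_zeta_le1 A1 j).
  by rewrite divr_ge0 ?(ltW z0)// !mulr_ge0.
have reg := run_regret hN hK hgl hr hgomega A1 A2 A3 A4 A5 heta hrho hrun j hT
  Kxs.
rewrite /avg_regret -mulrBr ler_pdivrMl//; apply: (le_trans reg).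
rewrite -/C !big_split/= !sumr_const_nat subn1/= -!mulr_sumr.
rewrite -(mulr_natl (eta * (Gl + Gr) / sigma)).
rewrite -(mulr_natl (eta * (Gl + Gr) ^+ 2 / _)).
set SA := \sum_(1 <= t < T.+1) Num.sqrt (eta * rho t).
set SB := \sum_(1 <= t < T.+1) Num.sqrt (rho t / eta).
set S1 := \sum_(i < m) bregman omega gomega xstar (x i 1%N);
  set SN := \sum_(i < m) N (x i 1%N).
set q := Num.sqrt (2 / sigma).
have SA0 : 0 <= SA by apply: sumr_ge0 => t _; exact: sqrtr_ge0.
have SB0 : 0 <= SB by apply: sumr_ge0 => t _; exact: sqrtr_ge0.
have SN0 : 0 <= SN by apply: sumr_ge0 => i _; exact: norm_ge0.
have q0 : 0 <= q by exact: sqrtr_ge0.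
have DK0 : 0 <= DK := le_trans (norm_ge0 hN _) (A2 _ _ Kxs Kxs).
have Ge0 := mirror_G_ge0 A4.
have mR0 : 0 <= m%:R :> R by [].
(* The difference of the two sides is a sum of nonnegative terms; Gr ^+ 2 / 2
   is Gl^2 / 2 + Gr (Gl + Gr) - (Gl + Gr)^2 / 2. *)
rewrite -subr_ge0; set gap := (X in 0 <= X).
have -> : gap = C * (Gl + Gr) * SN + T%:R * eta * m%:R / sigma * (Gr ^+ 2 / 2)
    + m%:R * q * Gl * SA + m%:R * q * Gomega * DK * SB.
  by rewrite /gap; field; rewrite !gt_eqF.
have G0 : 0 <= Gl + Gr by exact: addr_ge0.
have [T0' eta0] := (ltW T0, ltW heta).
have sV0 : 0 <= sigma^-1 by rewrite invr_ge0 ltW.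
clear reg; clearbody C.
have half0 : 0 <= 2^-1 :> R by rewrite invr_ge0.
by do 3 (apply: addr_ge0; last by do ?apply: mulr_ge0); do ?apply: mulr_ge0.
Qed.
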